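(* Let $c\ge 1$ and $q\ge 1$ be positive integers. Let $R_2(c,q)$ denote the two-color off-diagonal Rado number of the pair of equations $x+y+c=z$ (red) and $x+qy=z$ (blue), i.e. the smallest positive integer $N$ such that every red--blue coloring of $\{1,2,\dots,N\}$ contains either a red solution to $x+y+c=z$ or a blue solution to $x+qy=z$, with $R_2(c,q)=\infty$ if no such $N$ exists. Then \[ R_2(c,q)= \begin{cases} \infty, & \text{if } q \text{ is odd and } c \text{ is odd},\\ 2c+4, & \text{if } q=1 \text{ and } c \text{ is even},\\ (q+1)(c+2)+c+1, & \text{otherwise.} \end{cases} \]
   Context: A red--blue coloring of $\{1,\dots,N\}$ is a function $\chi:\{1,\dots,N\}\to\{\text{Red},\text{Blue}\}$. A red (respectively blue) solution of an equation in the variables $x,y,z$ is a triple $(x,y,z)$ of elements of $\{1,\dots,N\}$, not necessarily distinct (in particular $x=y$ is allowed), that satisfies the equation and such that $x$, $y$ and $z$ are all colored red (respectively blue). *)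

(* Defs.v *)
From mathcomp Require Import all_boot.
From mathcomp Require Import boolp.

Set Implicit Arguments.
Unset Strict Implicit.
Unset Printing Implicit Defensive.

Inductive color := Red | Blue.

Definition interval (N : nat) : Type := {n : nat | 1 <= n <= N}.

Definition coloring (N : nat) : Type := interval N -> color.

Definition equation : Type := nat -> nat -> nat -> Prop.

Definition has_solution (N : nat) (chi : coloring N) (k : color)
    (E : equation) : Prop :=
  exists x y z : interval N,
    [/\ chi x = k, chi y = k, chi z = k & E (val x) (val y) (val z)].

Definition unavoidable (Ered Eblue : equation) (N : nat) : Prop :=
  forall chi : coloring N,
    has_solution chi Red Ered \/ has_solution chi Blue Eblue.

(* [None] stands for the value infinity. *)
Definition rado_number (Ered Eblue : equation) : option nat :=
  if pselect (exists N, (0 < N) && `[< unavoidable Ered Eblue N >]) is left exN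
  then Some (ex_minn exN) else None.

Definition R2 (c q : nat) : option nat :=
  rado_number (fun x y z => x + y + c = z) (fun x y z => x + q * y = z).

(* Main.v *)
Require Import Defs.
From mathcomp Require Import all_boot.
From mathcomp Require Import boolp zify.

(** Lower bounds come from explicit colorings.  If [c] and [q] are both odd,
    parity decides: the sum [x + y + c] of two even numbers and [c] is odd, and
    [x + q * y] with [x] and [y] odd is even, so painting the even numbers red
    avoids both equations forever ([parity_coloring_avoids]).  Otherwise the
    coloring has red, blue, red blocks starting at 1, [c + 2] and
    [(q + 1) * (c + 2)].  Each block is as long as possible: [c + 2] and
    [(q + 1) * (c + 2)] are the least values produced by the red and by the
    blue numbers before them, and the last block stops before
    [1 + (q + 1) * (c + 2) + c].  When [q = 1] and [2 <= c], the third block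
    cannot even begin, because [2 * c + 4] is also the red sum of [c + 1], 3
    and [c]; this is why the value is smaller there.

    Upper bounds come from following the forced colors from the color of 1: two
    numbers of one color in a triple that satisfies the equation of that color
    force the other color on the third.  If 1 is red, the forced colors at
    [c + 2], [(q + 1) * (c + 2)] and [(q + 1) * (c + 2) + c + 1] are those of a
    continued block coloring, which makes [2 * c + 3] red and
    [q * (c + 2) + 1] blue; these numbers in turn act as mirrors on
    [1, ..., c + 2]: a red [k] has a blue [c + 3 - k], and a blue [k] has a red
    [c + 2 - k].  These constraints are contradictory whatever the parities
    ([one_is_blue]).  If 1 is blue, the cases [q] even and [c] even are settled
    separately, both by halving: a red [z] with [z - c] even has a blue
    [(z - c) / 2].  For [q] even this applies to two numbers that differ by
    [2 * q] ([one_is_red_even_q]); for [c] even it applies to [2 * c + 2]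
    ([one_is_red_even_c]).  For [q = 1] the interval is too short for these
    arguments and has its own chains ([avoids_q1_lt]). *)

(** * Avoiding colorings and forced colors *)

(** Coloring all natural numbers by a boolean, instead of only the interval
    by a [color], makes every forced color a plain boolean fact, with no
    membership proof to carry along. *)
Definition avoids (c q N : nat) (red : pred nat) : Prop :=
  (forall x y z, 0 < x -> 0 < y -> z <= N -> x + y + c = z ->
     red x -> red y -> red z -> False) /\
  (forall x y z, 0 < x -> 0 < y -> z <= N -> x + q * y = z ->
     ~~ red x -> ~~ red y -> ~~ red z -> False).

Lemma unavoidableE (c q N : nat) (hq : 0 < q) :
  unavoidable (fun x y z => x + y + c = z) (fun x y z => x + q * y = z) N <->
  forall red, ~ avoids c q N red.
Proof.
split=> [unav red [no_red no_blue] | no_avoid chi].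
  pose chi (i : interval N) := if red (val i) then Red else Blue.
  have chiR i : chi i = Red -> red (val i) by rewrite /chi; case: (red _).
  have chiB i : chi i = Blue -> ~~ red (val i) by rewrite /chi; case: (red _).
  case: (unav chi) => -[x [y [z [cx cy cz E]]]];
    have /andP[x0 _] := valP x; have /andP[y0 _] := valP y;
    have /andP[_ zN] := valP z.
    exact: (no_red _ _ _ x0 y0 zN E (chiR _ cx) (chiR _ cy) (chiR _ cz)).
  exact: (no_blue _ _ _ x0 y0 zN E (chiB _ cx) (chiB _ cy) (chiB _ cz)).
pose red n := if insub n is Some i then
  if chi i is Red then true else false else false.
have redE (i : interval N) : red (val i) = if chi i is Red then true else false.
  by rewrite /red valK.
have redR i : red (val i) -> chi i = Red by rewrite redE; case: (chi i).
have redB i : ~~ red (val i) -> chi i = Blue by rewrite redE; case: (chi i).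
have lift n : 0 < n -> n <= N -> exists i : interval N, val i = n.
  move=> n0 nN; have n_in : 0 < n <= N by rewrite n0.
  by exists (exist _ n n_in).
apply: contrapT => none; apply: (no_avoid red).
split=> x y z x0 y0 zN E; [have [xN yN] : x <= N /\ y <= N by lia|
    have [xN yN] : x <= N /\ y <= N by nia];
  have [i Ei] := lift x x0 xN; have [j Ej] := lift y y0 yN;
  have [k Ek] := lift z ltac:(lia) zN; rewrite -Ei -Ej -Ek => cx cy cz;
  apply: none; [left | right]; exists i, j, k; split; rewrite ?Ei ?Ej ?Ek //;
  solve [exact: redR | exact: redB].
Qed.

Lemma blue_sum {c q N red x y z} : avoids c q N red -> red x -> red y ->
  0 < x -> 0 < y -> z <= N -> x + y + c = z -> ~~ red z.
Proof. by move=> [av _] ? ? ? ? ? ?; apply/negP; apply: (av x y z). Qed.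

Lemma blue_summand {c q N red x y z} : avoids c q N red -> red x -> red z ->
  0 < x -> 0 < y -> z <= N -> x + y + c = z -> ~~ red y.
Proof. by move=> [av _] ? ? ? ? ? ?; apply/negP=> ?; apply: (av x y z). Qed.

Lemma blue_half {c q N red x z} : avoids c q N red -> red z ->
  0 < x -> z <= N -> x + x + c = z -> ~~ red x.
Proof. by move=> [av _] ? ? ? ?; apply/negP=> ?; apply: (av x x z). Qed.

Lemma red_image {c q N red x y z} : avoids c q N red -> ~~ red x -> ~~ red y ->
  0 < x -> 0 < y -> z <= N -> x + q * y = z -> red z.
Proof. by move=> [_ av] ? ? ? ? ? ?; apply/idPn; apply: (av x y z). Qed.

Lemma red_base {c q N red x y z} : avoids c q N red -> ~~ red y -> ~~ red z ->
  0 < x -> 0 < y -> z <= N -> x + q * y = z -> red x.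
Proof. by move=> [_ av] ? ? ? ? ? ?; apply/idPn=> ?; apply: (av x y z). Qed.

Lemma red_multiplier {c q N red x y z} :
  avoids c q N red -> ~~ red x -> ~~ red z ->
  0 < x -> 0 < y -> z <= N -> x + q * y = z -> red y.
Proof. by move=> [_ av] ? ? ? ? ? ?; apply/idPn=> ?; apply: (av x y z). Qed.

(** [lia] would split on every known color, doubling its work each time. *)
Ltac arith :=
  match goal with _ : avoids _ _ _ ?red |- _ =>
    repeat match goal with H : context [red] |- _ => clear H end
  end; first [lia | nia].

(** * Lower bounds *)

Lemma parity_coloring_avoids (c q N : nat) :
  odd c -> odd q -> avoids c q N (fun n => ~~ odd n).
Proof.
move=> oc oq; split=> x y z _ _ _ <-; rewrite !oddD ?oddM ?oc ?oq;
  by case: (odd x) (odd y) => [] [].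
Qed.

(** Inside the red blocks, the sums of two short numbers and [c] end at
    [3 * c + 2], below the last block as soon as [2 <= q]. *)
Lemma block_coloring_avoids (c q N : nat) :
  N <= (q + 1) * (c + 2) + c -> (1 < q) || (N < (q + 1) * (c + 2)) ->
  avoids c q N (fun n => (n <= c + 1) || ((q + 1) * (c + 2) <= n)).
Proof.
move=> leN hqN; split=> x y z x0 y0 zN E; first by nia.
rewrite !negb_or -!ltnNge => /andP[xa _] /andP[ya _] /andP[_ zM].
(* Both [x] and [y] are at least [c + 2], which puts [z] in the last block. *)
have : q * (c + 2) <= q * y by rewrite leq_mul2l; lia.
lia.
Qed.

(** * The case where 1 is red *)

(** The pivot is that [c + 1] is red.  Its mirror image 2 in [2 * c + 3] is then
    blue, and since [2 * c + 2] is blue as well, the red numbers [2 + 2 * q] and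
    [2 * c + 2 + 2 * q] make [c] blue; but 2 and [c] add up to [c + 2]. *)
Lemma one_is_blue (c q N : nat) (red : pred nat) : 0 < c -> 0 < q ->
  (q + 1) * (c + 2) + c + 1 <= N -> avoids c q N red -> ~~ red 1.
Proof.
move=> c0 q0 leN av; apply/negP=> R1.
have le_q : q <= q * c by rewrite leq_pmulr.
have Ba : ~~ red (c + 2) by apply: (blue_sum av R1 R1); arith.
have RM : red ((q + 1) * (c + 2)) by apply: (red_image av Ba Ba); arith.
have BN : ~~ red ((q + 1) * (c + 2) + c + 1).
  by apply: (blue_sum av RM R1); arith.
have R2a : red (2 * c + 3) by apply: (red_base av Ba BN); arith.
have Bqa : ~~ red (q * (c + 2) + 1) by apply: (blue_summand av R1 RM); arith.
(* Blue [k] and [l] would make [1 + q * l] and [1 + q * k] red through the blue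
   [q * (c + 2) + 1], and their red sum is the red [(q + 1) * (c + 2)]. *)
have mirror k l : k + l = c + 2 -> 0 < k -> 0 < l -> ~~ red k -> red l.
  move=> kl k0 l0 Bk; apply: contraT => Bl.
  have qkl : q * k + q * l = q * (c + 2) by rewrite -mulnDr kl.
  have Rl : red (1 + q * l) by apply: (red_base av Bk Bqa); arith.
  have Rk : red (1 + q * k) by apply: (red_base av Bl Bqa); arith.
  suff: ~~ red ((q + 1) * (c + 2)) by rewrite RM.
  by apply: (blue_sum av Rl Rk); arith.
have Rc1 : red (c + 1).
  case: (boolP (odd c)) => oc.
    (* Twice [1 + q * (h + 1)], plus [c], is [c + 2 + q * (c + 1)]. *)
    pose h := c./2; have Ec : c = 2 * h + 1 by rewrite /h; lia.
    have Bh : ~~ red (h + 2) by apply: (blue_half av R2a); arith.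
    have Rh : red (1 + q * (h + 1)) by apply: (red_base av Bh Bqa); arith.
    have B : ~~ red (c + 2 + q * (c + 1)) by apply: (blue_sum av Rh Rh); arith.
    by apply: (red_multiplier av Ba B); arith.
  pose h := c./2; have Ec : c = 2 * h by rewrite /h; lia.
  have Rh : red (h + 1).
    apply: contraT => Bh; rewrite -(negPf Bh).
    by apply: (mirror _ _ _ _ _ Bh); arith.
  have B2 : ~~ red (2 * c + 2) by apply: (blue_sum av Rh Rh); arith.
  apply: contraT => Bc1.
  have R : red (c + 1 + q * (c + 2)) by apply: (red_image av Bc1 Ba); arith.
  have B : ~~ red (2 * c + 2 + q * (c + 2)) by apply: (blue_sum av R R1); arith.
  suff R' : red (2 * c + 2 + q * (c + 2)) by rewrite R' in B.
  by apply: (red_image av B2 Ba); arith.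
have B2 : ~~ red 2 by apply: (blue_summand av Rc1 R2a); arith.
have B2c2 : ~~ red (2 * c + 2) by apply: (blue_sum av R1 Rc1); arith.
have R2q : red (2 + q * 2) by apply: (red_image av B2 B2); arith.
have R2c2q : red (2 * c + 2 + q * 2) by apply: (red_image av B2c2 B2); arith.
have Bc : ~~ red c by apply: (blue_summand av R2q R2c2q); arith.
suff Rc : red c by rewrite Rc in Bc.
by apply: (mirror 2 c _ _ _ B2); arith.
Qed.

(** * The case where 1 is blue *)

(** The red numbers [3 * q + 2 + c] and [q + 2 + c] have blue halves
    [3 * q / 2 + 1] and [q / 2 + 1]; these differ by [q * 1], and 1 is blue. *)
Lemma one_is_red_even_q (c q N : nat) (red : pred nat) : 0 < c -> 0 < q ->
  ~~ odd q -> (q + 1) * (c + 2) + c + 1 <= N -> avoids c q N red -> red 1.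
Proof.
move=> c0 q0 oq leN av; apply: contraT => B1.
have le_q : q <= q * c by rewrite leq_pmulr.
pose k := q./2; have Eq : q = 2 * k by rewrite /k; lia.
have R1 : red (q + 1) by apply: (red_image av B1 B1); arith.
have B2 : ~~ red (2 * q + 2 + c) by apply: (blue_sum av R1 R1); arith.
have R3 : red (3 * q + 2 + c) by apply: (red_image av B2 B1); arith.
have R4 : red (q + 2 + c) by apply: (red_base av B1 B2); arith.
have B3 : ~~ red (3 * k + 1) by apply: (blue_half av R3); arith.
have B4 : ~~ red (k + 1) by apply: (blue_half av R4); arith.
suff R5 : red (3 * k + 1) by rewrite R5 in B3.
by apply: (red_image av B4 B1); arith.
Qed.

(** Two routes lead from a blue 1 to [(q + 1) * (c + 2)].  As the blue image of
    [c + 2] with itself it is red; but it is also twice [1 + q * (c / 2 + 1)],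
    plus [c], and that number is red once [c / 2 + 1] is blue. *)
Lemma one_is_red_even_c (c q N : nat) (red : pred nat) : 0 < c -> 0 < q ->
  ~~ odd c -> (q + 1) * (c + 2) + c + 1 <= N -> avoids c q N red -> red 1.
Proof.
move=> c0 q0 oc leN av; apply: contraT => B1.
have le_q : q <= q * c by rewrite leq_pmulr.
pose h := c./2; have Ec : c = 2 * h by rewrite /h; lia.
have R1 : red (q + 1) by apply: (red_image av B1 B1); arith.
have B2 : ~~ red (2 * q + 2 + c) by apply: (blue_sum av R1 R1); arith.
have R3 : red (q + 2 + c) by apply: (red_base av B1 B2); arith.
have B4 : ~~ red (2 * q + 3 + 2 * c) by apply: (blue_sum av R1 R3); arith.
have R5 : red (q + 3 + 2 * c) by apply: (red_base av B1 B4); arith.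
have Ba : ~~ red (c + 2) by apply: (blue_summand av R1 R5); arith.
have RM : red ((q + 1) * (c + 2)) by apply: (red_image av Ba Ba); arith.
have B6 : ~~ red (1 + q * (c + 1)) by apply: (blue_summand av R1 RM); arith.
have R7 : red (c + 1) by apply: (red_multiplier av B1 B6); arith.
have B8 : ~~ red (2 * c + 2 + q) by apply: (blue_sum av R1 R7); arith.
have R9 : red (2 * c + 2) by apply: (red_base av B1 B8); arith.
have Bh : ~~ red (h + 1) by apply: (blue_half av R9); arith.
have Rh : red (1 + q * (h + 1)) by apply: (red_image av B1 Bh); arith.
suff: ~~ red ((q + 1) * (c + 2)) by rewrite RM.
by apply: (blue_sum av Rh Rh); arith.
Qed.

(** * The case [q = 1] *)

(** If 1 is red, doubling [c / 2 + 2], which is blue because [2 * c + 4] is red,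
    gives a red [c + 4]; this makes 2 blue, and then [c], so that 2, [c] and
    [c + 2] form a blue solution.  If 1 is blue, 2 and [c + 1] are red and lead
    to the red solution 2, [c], [2 * c + 2]. *)
Lemma avoids_q1_lt (c N : nat) (red : pred nat) : 0 < c -> ~~ odd c ->
  avoids c 1 N red -> N < 2 * c + 4.
Proof.
move=> c0 oc av; rewrite ltnNge; apply/negP=> leN.
pose h := c./2; have Ec : c = 2 * h by rewrite /h; lia.
case: (boolP (red 1)) => [R1 | B1].
  have Ba : ~~ red (c + 2) by apply: (blue_sum av R1 R1); arith.
  have RM : red (2 * c + 4) by apply: (red_image av Ba Ba); arith.
  have Bh : ~~ red (h + 2) by apply: (blue_half av RM); arith.
  have R1' : red (c + 4) by apply: (red_image av Bh Bh); arith.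
  have B2 : ~~ red 2 by apply: (blue_half av R1'); arith.
  have R4 : red 4 by apply: (red_image av B2 B2); arith.
  have Bc : ~~ red c by apply: (blue_summand av R4 RM); arith.
  suff Ra : red (c + 2) by rewrite Ra in Ba.
  by apply: (red_image av Bc B2); arith.
have R2 : red 2 by apply: (red_image av B1 B1); arith.
have B3 : ~~ red (c + 4) by apply: (blue_sum av R2 R2); arith.
have R4 : red (c + 5) by apply: (red_image av B3 B1); arith.
have B5 : ~~ red 3 by apply: (blue_summand av R2 R4); arith.
have R6 : red (c + 1) by apply: (red_base av B5 B3); arith.
have B7 : ~~ red (2 * c + 3) by apply: (blue_sum av R2 R6); arith.
have R8 : red (2 * c + 2) by apply: (red_base av B1 B7); arith.
have Bh : ~~ red (h + 1) by apply: (blue_half av R8); arith.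
have Ra : red (c + 2) by apply: (red_image av Bh Bh); arith.
have BM : ~~ red (2 * c + 4) by apply: (blue_sum av R2 Ra); arith.
have Rc : red c by apply: (red_base av B3 BM); arith.
suff: ~~ red (2 * c + 2) by rewrite R8.
by apply: (blue_sum av R2 Rc); arith.
Qed.

(** * The Rado number *)

Lemma R2_eq_None (c q : nat) : 0 < q ->
  (forall N, exists red, avoids c q N red) -> R2 c q = None.
Proof.
move=> q0 av; rewrite /R2 /rado_number; case: pselect => // exN; exfalso.
case: exN => N /andP[_ /asboolP/(unavoidableE _ _ _ q0) unav].
by have [red /unav] := av N.
Qed.

Lemma R2_eq_Some (c q n : nat) : 0 < q -> 0 < n ->
  (forall red, ~ avoids c q n red) ->
  (forall N, N < n -> exists red, avoids c q N red) -> R2 c q = Some n.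
Proof.
move=> q0 n0 none av; rewrite /R2 /rado_number.
have n_ok : (0 < n) && `[< unavoidable (fun x y z => x + y + c = z)
    (fun x y z => x + q * y = z) n >].
  by rewrite n0; apply/asboolP/unavoidableE.
case: pselect => [exN | []]; last by exists n.
congr Some; case: ex_minnP => m /andP[_ /asboolP/(unavoidableE _ _ _ q0) unav].
move=> /(_ n n_ok) le_mn; apply/eqP; rewrite eqn_leq le_mn leqNgt.
by apply/negP => /av[red /unav].
Qed.

Theorem theorem1 (c q : nat) (hc : 1 <= c) (hq : 1 <= q) :
  R2 c q =
    if odd q && odd c then None
    else if (q == 1) && ~~ odd c then Some (2 * c + 4)
    else Some ((q + 1) * (c + 2) + c + 1).
Proof.
case: ifP => [/andP[oq oc] | odd_qc].
  apply: R2_eq_None => // N; exists (fun n => ~~ odd n).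
  exact: parity_coloring_avoids.
case: ifP => [/andP[/eqP q1 oc] | q1c].
  rewrite q1; apply: R2_eq_Some => //; first by lia.
    by move=> red /(avoids_q1_lt _ _ _ hc oc); rewrite ltnn.
  by move=> N ltN; eexists; apply: block_coloring_avoids; lia.
have q_gt1 : 1 < q by lia.
apply: R2_eq_Some => //; first by lia.
  move=> red av; have /negP B1 := one_is_blue _ _ _ _ hc hq (leqnn _) av.
  apply: B1; case: (boolP (odd c)) => oc.
    by apply: one_is_red_even_q av => //; move: odd_qc; rewrite oc andbT => ->.
  exact: one_is_red_even_c av.
by move=> N ltN; eexists; apply: block_coloring_avoids; lia.
Qed.
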